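(* Let $d$ be a positive integer and $F(t)=\sum_{n\ge 0}f_nt^n=\sum_{i=0}^{d}t^i$. For every partition $\lambda$, $s_\lambda^F=\det\big(f_{\lambda_i-i+j}\big)_{1\le i,j\le \ell(\lambda)}$, and this number is $\pm1$ or $0$. More precisely, $$s_\lambda^F=\begin{cases}(-1)^{|\lambda|+d+r}\,\mathrm{sign}(\sigma), & \text{if } \lambda'+\delta_d=\sigma(\delta_{d+1}\setminus r)\text{ in }\mathbb{Z}/(d+1)\mathbb{Z}\text{ for some }\sigma\in S_d \text{ and some } 0\le r\le d,\\ 0,&\text{otherwise.}\end{cases}$$
   Context: For a power series $F(t)=\sum_{n\ge0}f_nt^n$ with $f_0=1$ (and $f_k=0$ for $k<0$), $s_\lambda^F$ denotes the coefficient of the Schur function $s_\lambda(x)$ in the Schur expansion $\prod_iF(x_i)=\sum_\lambda s_\lambda^F s_\lambda(x)$, where $x=(x_1,x_2,\ldots)$. $\lambda'$ is the conjugate partition of $\lambda$ and $\ell(\lambda)$ the number of nonzero parts. $\delta_d=(d-1,d-2,\ldots,1,0)$. If $\ell(\lambda')\le d$, then $\lambda'+\delta_d=(\lambda'_1+d-1,\lambda'_2+d-2,\ldots,\lambda'_d)$ (pad $\lambda'$ with zeros); if $\ell(\lambda')>d$, the condition in the first case is considered not to hold. For $0\le r\le d$, $\delta_{d+1}\setminus r=(d,d-1,\ldots,r+1,r-1,\ldots,1,0)$, a sequence of length $d$. The condition ''$\lambda'+\delta_d=\sigma(\delta_{d+1}\setminus r)$ in $\mathbb{Z}/(d+1)\mathbb{Z}$''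 means that, after reducing all entries modulo $d+1$, the sequence $\lambda'+\delta_d$ is obtained from $\delta_{d+1}\setminus r$ by permuting its entries by the permutation $\sigma\in S_d$. *)

(* Defs.v *)
From mathcomp Require Import all_boot all_order all_fingroup all_algebra.
From mathcomp Require Import mpoly.
From Stdlib Require Import ClassicalEpsilon.

Set Implicit Arguments.
Unset Strict Implicit.
Unset Printing Implicit Defensive.

Import Order.TTheory GRing.Theory Num.Theory.

Local Open Scope ring_scope.

(* Partitions are weakly decreasing sequences of positive integers, so that   *)
(* |lam| = sumn lam, l(lam) = size lam, and lam_i = nth 0 lam i, where i      *)
(* starts from 0.                                                             *)
Definition is_part (lam : seq nat) : bool :=
  sorted geq lam && all (leq 1) lam.

Definition conj_part (lam : seq nat) : seq nat :=
  mkseq (fun j => count (fun p => j < p)%N lam) (head 0%N lam).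

Definition partitions_of (k : nat) : seq (seq nat) :=
  [seq lam <- [seq map val (t : l.-tuple 'I_k.+1)
                | l <- iota 0 k.+1, t <- enum {: l.-tuple 'I_k.+1}]
          | is_part lam && (sumn lam == k)].

Lemma mem_partitions_of k lam :
  (lam \in partitions_of k) = is_part lam && (sumn lam == k).
Proof.
rewrite mem_filter; apply: andb_idr => /andP[/andP[_ lam_gt0] /eqP lam_sum].
have lek x : x \in lam -> (x < k.+1)%N.
  rewrite ltnS -lam_sum; elim: lam {lam_gt0 lam_sum} => //= y s IHs.
  by rewrite inE => /orP[/eqP-> | /IHs/leq_trans->//]; rewrite (leq_addr, leq_addl).
have size_lam : (size lam < k.+1)%N.
  rewrite ltnS -lam_sum; elim: lam lam_gt0 {lam_sum lek} => //= y s IHs.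
  by case/andP=> y_gt0 /IHs; rewrite -add1n; apply: leq_add.
apply/allpairsPdep; exists (size lam), [tuple of map (@inord k) (in_tuple lam)]; split.
- by rewrite mem_iota.
- by rewrite mem_enum.
- rewrite -map_comp -[LHS]map_id; apply/eq_in_map => x /lek ltx /=.
  by rewrite inordK.
Qed.

Lemma partitions_of_uniq k : uniq (partitions_of k).
Proof.
apply: filter_uniq; apply: allpairs_uniq_dep => [|l _|].
- exact: iota_uniq.
- exact: enum_uniq.
move=> [l t] [l' t'] _ _ /= eqt.
have El : l = l' by rewrite -(size_tuple t) -(size_map val) eqt size_map size_tuple.
case: l' / El t' eqt => t' /(inj_map val_inj) eqt.
by congr existT; apply: val_inj.
Qed.

Definition cell (lam : seq nat) : finType :=
  {i : 'I_(size lam) & 'I_(nth 0%N lam i)}.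

Definition row_of (lam : seq nat) (c : cell lam) : nat := tag c.
Definition col_of (lam : seq nat) (c : cell lam) : nat := tagged c.

Definition semistandard (n : nat) (lam : seq nat)
    (T : {ffun cell lam -> 'I_n}) : bool :=
  [forall c, forall c',
     ((row_of c == row_of c') && (col_of c < col_of c')%N ==> (T c <= T c')%N)
  && ((col_of c == col_of c') && (row_of c < row_of c')%N ==> (T c < T c')%N)].

(* The Schur function s_lam restricted to n variables, i.e. with all          *)
(* variables but the first n set to 0.                                        *)
Definition schur (R : comNzRingType) (n : nat) (lam : seq nat) : {mpoly R[n]} :=
  \sum_(T : {ffun cell lam -> 'I_n} | semistandard T) \prod_(c : cell lam) 'X_(T c).

(* prod_i F(x_i) = sum_lam (s lam) s_lam(x) in infinitely many variables,     *)
(* for F(t) = sum_n (f n) t^n with f 0 = 1, compared monomial by monomial: a  *)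
(* monomial in x_1, x_2, ... is x_1^(m_1) ... x_n^(m_n) for some n; its       *)
(* coefficient in the product is prod_(i <= n) f_(m_i), since the remaining   *)
(* factors contribute f 0 = 1, and since s_lam is homogeneous of degree |lam| *)
(* only the partitions of m_1 + ... + m_n matter on the right.                *)
Definition is_schur_expansion (R : comNzRingType) (f : nat -> R)
    (s : seq nat -> R) : Prop :=
  forall (n : nat) (m : 'X_{1..n}),
    \prod_(i < n) f (m i)
    = \sum_(lam <- partitions_of (mdeg m)) s lam * (schur R n lam)@_m.

(* Only the values at partitions are meaningful; these are unique because     *)
(* the Schur functions form a basis.                                          *)
Definition schur_coef (R : comNzRingType) (f : nat -> R) : seq nat -> R :=
  epsilon (inhabits (fun _ : seq nat => 0)) (is_schur_expansion f).

Definition coefz (R : comNzRingType) (f : nat -> R) (k : int) : R :=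
  if k is Posz n then f n else 0.

Definition geom_coef (d n : nat) : int := (\sum_(i < d.+1) 'X^i : {poly int})`_n.

Definition delta (d : nat) : seq nat := rev (iota 0 d).

Definition delta_minus (d r : nat) : seq nat := [seq x <- delta d.+1 | x != r].

(* lam' + delta_d = sigma (delta_(d+1) \ r) in Z/(d+1)Z. Whether sigma or its *)
(* inverse acts on the indices does not affect the sign.                      *)
Definition congr_delta (d : nat) (lam : seq nat) (r : 'I_d.+1) (sigma : 'S_d)
    : Prop :=
  (size (conj_part lam) <= d)%N /\
  forall i : 'I_d,
    (nth 0 (conj_part lam) i + nth 0 (delta d) i
     = nth 0 (delta_minus d r) (sigma i) %[mod d.+1])%N.

(* Main.v *)
Require Import Defs.
From mathcomp Require Import all_boot all_order all_fingroup all_algebra.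
From mathcomp Require Import mpoly zify ring.
From Stdlib Require Import ClassicalEpsilon.

(* A function s on partitions with s(empty) = 1 satisfies                     *)
(* prod_i F(x_i) = sum_lam s(lam) s_lam(x) as soon as it obeys the Pieri rule *)
(* f_m s(mu) = sum of s(lam) over the lam such that lam / mu is a horizontal  *)
(* m-strip: peel off the last variable. Two such functions agree on           *)
(* partitions, by unitriangularity of the Kostka numbers. So it suffices to   *)
(* check the Pieri rule for both sides of the theorem.                        *)
(*   For det(f_(lam_i - i + j)), the sum over horizontal strips is a          *)
(* determinant whose rows telescope. For the signed number, put the beta      *)
(* numbers lam'_j + d - j modulo d + 1 as unit rows below a row of ones:      *)
(* adding a horizontal strip raises some of the beta numbers by 1, so the     *)
(* generating function of the sum over strips is the product with the         *)
(* characteristic matrix of the cyclic shift, whose determinant is            *)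
(* t^(d+1) - 1; the row of ones contributes a factor t - 1.                   *)

Set Implicit Arguments.
Unset Strict Implicit.
Unset Printing Implicit Defensive.

Import Order.TTheory GRing.Theory Num.Theory.

Local Open Scope ring_scope.

(** * Partitions *)

Section Partitions.
Local Open Scope nat_scope.

(** The coefficients in question are the values on Schur functions of the ring homomorphism sending
    h_m to [f m], and the Pieri rule for s_mu h_m pins such values down; hence the single test
    [pieri_rule] serves for both formulas. It implies the expansion ([schur_expansion_of_pieri])
    because removing the largest entry of a tableau removes a horizontal strip ([schur_branching]),
    and the expansion determines the values on partitions ([schur_expansion_uniq]) by
    [schur_triangular].

    Both candidates are determinants that depend on beta numbers row by row, so multilinearity
    ([det_sum_rows]) turns a sum over strips into one determinant over polynomials, the exponent of
    X recording the size of the strip. In [jacobi_trudi_strips] the beta numbers of the rows range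
    over disjoint intervals bounded by those of mu; a unipotent row operation and a unipotent column
    operation, both telescoping, leave F(X) times a monomial times the determinant for mu.

    In [det_cyclic_mx_shifts] the beta numbers of the columns are each raised by 0 or 1. Choices
    that do not come from a partition make two rows equal and contribute 0. The cyclic determinant
    itself is a signed permutation sign when the [d] residues are distinct ([det_cyclic_mx_perm])
    and 0 otherwise ([det_cyclic_mx_eq0]), which yields the case distinction and the values 1, -1,
    0. *)

Lemma geq_trans : transitive geq.
Proof. by move=> y x z /= le_yx le_zy; apply: leq_trans le_zy le_yx. Qed.

Lemma part_nth_anti lam i j :
  is_part lam -> i <= j -> nth 0 lam j <= nth 0 lam i.
Proof.
case/andP=> lam_sorted _ leij.
have [lt_j | ge_j] := ltnP j (size lam); last by rewrite nth_default.
by apply: (sorted_leq_nth geq_trans leqnn 0 lam_sorted) => //;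
  rewrite inE // (leq_ltn_trans leij).
Qed.

Lemma part_nth_gt0 lam i : is_part lam -> (0 < nth 0 lam i) = (i < size lam).
Proof.
case/andP=> _ lam_gt0; have [lt_i | ge_i] := ltnP i (size lam).
  by rewrite (allP lam_gt0) ?mem_nth.
by rewrite nth_default.
Qed.

Lemma eq_part lam mu :
  is_part lam -> is_part mu -> nth 0 lam =1 nth 0 mu -> lam = mu.
Proof.
move=> plam pmu eq_nth; have eq_lt i : (i < size lam) = (i < size mu).
  by rewrite -!part_nth_gt0 ?eq_nth.
apply: (@eq_from_nth _ 0) => //.
by have := eq_lt (size lam); have := eq_lt (size mu); rewrite !ltnn; lia.
Qed.

(** Converts a row-length function back into a partition; the inverses of the later bijections are
    built with it. *)
Definition part_of (g : nat -> nat) (n : nat) : seq nat :=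
  [seq x <- mkseq g n | 0 < x].

Lemma part_ofP g n :
  (forall i, g i.+1 <= g i) -> g n = 0 ->
  is_part (part_of g n) /\ nth 0 (part_of g n) =1 g.
Proof.
move=> g_anti gn0.
have anti i j : i <= j -> g j <= g i.
  move=> /subnK<-; elim: (j - i) => // k IHk.
  by rewrite addSn; apply: leq_trans (g_anti _) IHk.
split.
  rewrite /is_part filter_all andbT sorted_filter //; first exact: geq_trans.
  apply/(sortedP 0) => i; rewrite size_mkseq => lt_i.
  by rewrite !nth_mkseq //; [apply: anti | lia].
rewrite /part_of => i; elim: n gn0 => [|n IHn] gn0.
  rewrite nth_nil; apply/esym/eqP; rewrite -leqn0 -gn0; exact: anti.
rewrite mkseqS filter_rcons; have [gn_0 | gn_gt0] := posnP (g n); first exact: IHn.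
rewrite (_ : filter _ _ = mkseq g n); last first.
  apply/all_filterP/allP => x /mapP[j]; rewrite mem_iota => /andP[_ lt_j] ->.
  by apply: leq_trans gn_gt0 (anti _ _ _); lia.
rewrite -mkseqS; have [lt_i | ge_i] := ltnP i n.+1; first by rewrite nth_mkseq.
rewrite nth_default ?size_mkseq //; apply/esym/eqP; rewrite -leqn0 -gn0.
exact: anti.
Qed.

Lemma sumn_nth lam n : size lam <= n -> sumn lam = \sum_(i < n) nth 0 lam i.
Proof.
move=> le_n; rewrite sumnE (big_nth 0) big_mkord (big_ord_widen n (nth 0 lam)) //.
by rewrite big_mkcond; apply: eq_bigr => i _; case: ltnP => // /(nth_default 0).
Qed.

(** Interlacing of lam and mu, checked on a finite range so that it is boolean; beyond this range
    all rows are 0. *)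
Definition hstrip (lam mu : seq nat) : bool :=
  all (fun i => (nth 0 mu i <= nth 0 lam i) && (nth 0 lam i.+1 <= nth 0 mu i))
      (iota 0 (size lam + size mu)).

Lemma hstripP lam mu :
  reflect (forall i, nth 0 mu i <= nth 0 lam i /\ nth 0 lam i.+1 <= nth 0 mu i)
          (hstrip lam mu).
Proof.
apply: (iffP allP) => [hs i | hs i _]; last by apply/andP; apply: hs.
have [lt_i | ge_i] := ltnP i (size lam + size mu).
  by apply/andP/hs; rewrite mem_iota.
by rewrite !nth_default //; lia.
Qed.

(** The parts exceeding [j] form an initial segment, so both sides say that the cell in row [i] and
    column [j] lies in the diagram. Most facts about conjugates below are read off from this
    equivalence. *)
Lemma conj_part_lt lam i j :
  is_part lam -> (i < nth 0 (conj_part lam) j) = (j < nth 0 lam i).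
Proof.
move=> plam; have nth0E : head 0 lam = nth 0 lam 0 by case: (lam).
have [lt_j | ge_j] := ltnP j (head 0 lam); last first.
  rewrite nth_default ?size_mkseq // ltn0; apply/esym/negbTE; rewrite -leqNgt.
  by apply: leq_trans ge_j; rewrite nth0E part_nth_anti.
rewrite nth_mkseq //.
have count_take k : k <= size lam -> j < nth 0 lam k.-1 ->
    k <= count (fun p => j < p) lam.
  move=> le_k lt_jk; rewrite -(cat_take_drop k lam) count_cat.
  apply: leq_trans (leq_addr _ _).
  suff /eqP-> : count (fun p => j < p) (take k lam) == size (take k lam).
    by rewrite size_takel.
  rewrite -all_count; apply/(all_nthP 0) => i'; rewrite size_takel // => lt_i'.
  rewrite nth_take //; apply: leq_trans lt_jk (part_nth_anti plam _); lia.
have count_drop k : nth 0 lam k <= j -> count (fun p => j < p) lam <= k.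
  move=> le_jk; rewrite -(cat_take_drop k lam) count_cat.
  suff /eqP-> : count (fun p => j < p) (drop k lam) == 0.
    rewrite addn0; apply: leq_trans (count_size _ _) _; by rewrite size_take_min geq_minl.
  rewrite -leqn0 leqNgt -has_count; apply/(has_nthP 0) => -[i' lt_i'].
  rewrite nth_drop ltnNge => /negP[]; apply: leq_trans le_jk.
  by rewrite part_nth_anti ?leq_addr.
apply/idP/idP => [|lt_ji]; last first.
  apply: (count_take i.+1) => //; rewrite -part_nth_gt0 //.
  exact: leq_trans lt_ji.
by move=> lt_i; rewrite ltnNge; apply/negP => /count_drop; lia.
Qed.

Lemma is_part_conj lam : is_part lam -> is_part (conj_part lam).
Proof.
move=> plam; have nth0E : head 0 lam = nth 0 lam 0 by case: (lam).
apply/andP; split.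
  apply/(sortedP 0) => j _; rewrite /geq /= leqNgt; apply/negP.
  by rewrite conj_part_lt // => lt_j; have := conj_part_lt
    (nth 0 (conj_part lam) j) j plam; rewrite ltnn; lia.
apply/(all_nthP 0) => j; rewrite size_mkseq => lt_j.
by rewrite conj_part_lt // -nth0E.
Qed.

Lemma conj_partK lam : is_part lam -> conj_part (conj_part lam) = lam.
Proof.
move=> plam; apply: eq_part => // [|i]; first by do 2!apply: is_part_conj.
have eq_lt j : (j < nth 0 (conj_part (conj_part lam)) i) = (j < nth 0 lam i).
  by rewrite !conj_part_lt ?is_part_conj.
have := eq_lt (nth 0 lam i); have := eq_lt (nth 0 (conj_part (conj_part lam)) i).
rewrite !ltnn; lia.
Qed.

Lemma size_conj_part lam : size (conj_part lam) = nth 0 lam 0.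
Proof. by rewrite size_mkseq; case: lam. Qed.

Lemma sumn_conj lam : is_part lam -> sumn (conj_part lam) = sumn lam.
Proof.
move=> plam; rewrite (sumn_nth (leqnn _)) [RHS](sumn_nth (leqnn _)).
set a := size _; set b := size lam.
transitivity (\sum_(j < a) \sum_(i < b) (j < nth 0 lam i)); last first.
  rewrite exchange_big; apply: eq_bigr => i _.
  have le_a : nth 0 lam i <= a by rewrite /a size_conj_part part_nth_anti.
  by rewrite -big_mkcond -(big_ord_widen a (fun=> 1)) // sum1_card card_ord.
apply: eq_bigr => j _.
have le_b : nth 0 (conj_part lam) j <= b.
  by rewrite leqNgt conj_part_lt // nth_default.
rewrite -{1}(card_ord (nth 0 _ j)) -sum1_card (big_ord_widen b (fun=> 1)) //.
by rewrite big_mkcond; apply: eq_bigr => i _; rewrite conj_part_lt.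
Qed.

(** No column receives two cells, so a strip amounts to a 0/1 choice for each column, which is the
    form used on the cyclic side. *)
Lemma hstrip_conjP lam mu : is_part lam -> is_part mu ->
  reflect (forall j, nth 0 (conj_part mu) j <= nth 0 (conj_part lam) j
                       <= (nth 0 (conj_part mu) j).+1)
          (hstrip lam mu).
Proof.
move=> plam pmu; apply: (iffP (hstripP _ _)) => hs k.
  apply/andP; split; rewrite leqNgt; apply/negP.
    rewrite conj_part_lt // => lt_k; have [le_k _] := hs (nth 0 (conj_part lam) k).
    have := conj_part_lt (nth 0 (conj_part lam) k) k plam; lia.
  rewrite conj_part_lt // => lt_k; have [_ le_k] := hs (nth 0 (conj_part mu) k).
  have := conj_part_lt (nth 0 (conj_part mu) k) k pmu; lia.
split; rewrite leqNgt; apply/negP; rewrite -conj_part_lt //.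
  have := hs (nth 0 lam k); have := conj_part_lt k (nth 0 lam k) plam; lia.
have := hs (nth 0 mu k); have := conj_part_lt k (nth 0 mu k) pmu; lia.
Qed.

End Partitions.

(** * Semistandard tableaux *)

Section Tableaux.
Local Open Scope nat_scope.
Implicit Types (lam mu : seq nat) (n : nat).

Lemma row_of_lt lam (c : cell lam) : row_of c < size lam.
Proof. exact: ltn_ord (tag c). Qed.

Lemma col_of_lt lam (c : cell lam) : col_of c < nth 0 lam (row_of c).
Proof. exact: ltn_ord (tagged c). Qed.

Lemma cellP lam i j :
  j < nth 0 lam i -> exists c : cell lam, row_of c = i /\ col_of c = j.
Proof.
move=> lt_j; have lt_i : i < size lam.
  by rewrite ltnNge; apply/negP => ge_i; rewrite nth_default in lt_j.
exists (Tagged (fun i : 'I_(size lam) => 'I_(nth 0 lam i))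
          (Ordinal lt_j : 'I_(nth 0 lam (Ordinal lt_i)))).
by [].
Qed.

Lemma cell_inj lam (c c' : cell lam) :
  row_of c = row_of c' -> col_of c = col_of c' -> c = c'.
Proof.
case: c c' => [i j] [i' j']; rewrite /row_of /col_of /= => /val_inj eq_i.
by case: i' / eq_i j' => j' /val_inj->.
Qed.

Lemma sum_cell lam (F : nat -> nat) :
  \sum_(c : cell lam) F (row_of c) = \sum_(i < size lam) nth 0 lam i * F i.
Proof.
rewrite -(sig_big_dep xpredT (fun i : 'I_(size lam) => xpredT) (fun i _ => F i)).
by apply: eq_bigr => i _; rewrite sum_nat_const card_ord.
Qed.

Lemma semistandardP n lam (T : {ffun cell lam -> 'I_n}) :
  reflect (forall c c' : cell lam,
             (row_of c = row_of c' -> col_of c < col_of c' -> T c <= T c')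
          /\ (col_of c = col_of c' -> row_of c < row_of c' -> T c < T c'))
          (semistandard T).
Proof.
apply: (iffP 'forall_forallP) => ss c c'; have := ss c c'.
  case/andP=> /implyP ss1 /implyP ss2; split=> eq_rc lt_rc.
    by apply: ss1; rewrite eq_rc eqxx.
  by apply: ss2; rewrite eq_rc eqxx.
case=> ss1 ss2; apply/andP; split; apply/implyP => /andP[/eqP eq_rc lt_rc].
  exact: ss1.
exact: ss2.
Qed.

Lemma semistandard_row n lam (T : {ffun cell lam -> 'I_n}) c :
  is_part lam -> semistandard T -> row_of c <= T c.
Proof.
move=> plam /semistandardP ss; move: {2}(row_of c) (erefl (row_of c)) => i.
elim: i c => [|i IHi] c row_c; first by rewrite row_c.
have [|c' [row_c' col_c']] := @cellP lam i (col_of c).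
  apply: leq_trans (col_of_lt c) _; rewrite row_c; exact: part_nth_anti.
have [_ /(_ col_c')] := ss c' c; have := IHi c' row_c'; lia.
Qed.

Definition content n lam (T : {ffun cell lam -> 'I_n}) : 'X_{1..n} :=
  [multinom \sum_(c : cell lam) (T c == i) | i < n].

Lemma contentE n lam (T : {ffun cell lam -> 'I_n}) i :
  content T i = \sum_(c : cell lam) (T c == i).
Proof. exact: mnmE. Qed.

Lemma sum_content n lam (T : {ffun cell lam -> 'I_n}) (F : nat -> nat) :
  \sum_(i < n) content T i * F i = \sum_(c : cell lam) F (T c).
Proof.
rewrite (eq_bigr (fun i : 'I_n => \sum_(c : cell lam) (T c == i) * F i)); last first.
  by move=> i _; rewrite contentE big_distrl.
rewrite exchange_big; apply: eq_bigr => c _.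
rewrite (bigD1 (T c)) //= eqxx mul1n big1 ?addn0 // => i.
by rewrite eq_sym => /negbTE->.
Qed.

Lemma mdeg_content n lam (T : {ffun cell lam -> 'I_n}) :
  mdeg (content T) = sumn lam.
Proof.
rewrite mdegE (eq_bigr (fun i => content T i * 1)); last by move=> i; rewrite muln1.
rewrite (sum_content T (fun=> 1)) (sum_cell lam (fun=> 1)) (sumn_nth (leqnn _)).
by apply: eq_bigr => i _; rewrite muln1.
Qed.

Lemma schur_mcoeff (R : comNzRingType) n lam (m : 'X_{1..n}) :
  ((schur R n lam)@_m
   = #|[set T : {ffun cell lam -> 'I_n} | semistandard T && (content T == m)]|%:R)%R.
Proof.
rewrite /schur raddf_sum -sum1_card natr_sum big_mkcond [RHS]big_mkcond.
apply: eq_bigr => T _; rewrite inE; case: (semistandard T) => //=.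
rewrite mprodXE mcoeffX (_ : (\sum_c U_(T c))%MM = content T); first by case: eqP.
apply/mnmP => i; rewrite mnm_sumE contentE; apply: eq_bigr => c _; exact: mnm1E.
Qed.

(** The statistic n(lam), the sum of i lam_i with i from 0; it orders partitions for the
    triangularity argument. *)
Definition row_sum lam : nat := \sum_(c : cell lam) row_of c.

Definition part_mnm nu : 'X_{1..size nu} := [multinom nth 0 nu i | i < size nu].

Lemma mdeg_part_mnm nu : mdeg (part_mnm nu) = sumn nu.
Proof. by rewrite mdegE (sumn_nth (leqnn _)); apply: eq_bigr => i _; rewrite mnmE. Qed.

(* Entries dominate row indices, and the entries add up to [row_sum nu].      *)
Lemma content_part_mnm lam nu (T : {ffun cell lam -> 'I_(size nu)}) :
  is_part lam -> semistandard T -> content T = part_mnm nu ->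
  row_sum lam <= row_sum nu ?= iff [forall c, row_of c == T c :> nat].
Proof.
move=> plam ssT cT; rewrite [row_sum nu](sum_cell nu id).
rewrite (eq_bigr (fun i : 'I__ => content T i * i)); last first.
  by move=> i _; rewrite cT mnmE.
rewrite (sum_content T id) /row_sum.
by apply: leqif_sum => c _; split=> //; apply: semistandard_row.
Qed.

Lemma sum_row_eq lam i : \sum_(c : cell lam) (row_of c == i) = nth 0 lam i.
Proof.
rewrite (sum_cell lam (fun k => nat_of_bool (k == i))).
have [lt_i | ge_i] := ltnP i (size lam); last first.
  rewrite nth_default // big1 // => k _; case: eqP => [eq_ki | _]; last exact: muln0.
  by have := ltn_ord k; lia.
rewrite (bigD1 (Ordinal lt_i)) //= eqxx muln1 big1 ?addn0 // => k ne_k.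
by case: eqP => [eq_ki | _]; [case/eqP: ne_k; apply: val_inj | rewrite muln0].
Qed.

(** The coefficient is a Kostka number. A tableau of shape lam and content nu forces n(lam) <=
    n(nu); with the assumed reverse inequality every entry equals its row index, so lam = nu and the
    tableau is unique. *)
Lemma schur_triangular (R : comNzRingType) lam nu :
  is_part lam -> is_part nu -> row_sum nu <= row_sum lam ->
  ((schur R (size nu) lam)@_(part_mnm nu) = (lam == nu)%:R)%R.
Proof.
move=> plam pnu le_sum; rewrite schur_mcoeff; set A := [set T | _].
have rowT T : T \in A -> forall c, row_of c = T c :> nat.
  rewrite inE => /andP[ssT /eqP cT] c; apply/eqP; move: c; apply/forallP.
  rewrite -(content_part_mnm plam ssT cT) eqn_leq le_sum andbT.
  exact: content_part_mnm ssT cT.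
case: eqP => [eq_lam | ne_lam]; last first.
  have [->|[T TA]] := set_0Vmem A; first by rewrite cards0.
  case: ne_lam; apply: eq_part => // i; rewrite -(sum_row_eq lam).
  have [lt_i | ge_i] := ltnP i (size nu); last first.
    rewrite nth_default // big1 // => c _; rewrite (rowT T) //.
    by case: eqP => // eq_i; have := ltn_ord (T c); lia.
  have := TA; rewrite inE => /andP[_ /eqP/mnmP/(_ (Ordinal lt_i))].
  by rewrite contentE mnmE => /= <-; apply: eq_bigr => c _; rewrite (rowT T).
case: nu / eq_lam {pnu le_sum} @A rowT => A rowT.
suff -> : A = [set [ffun c => Ordinal (row_of_lt c)]] by rewrite cards1.
apply/setP => T; rewrite in_set1; apply/idP/eqP => [TA | ->].
  by apply/ffunP => c; apply: val_inj; rewrite ffunE /= (rowT T).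
rewrite inE; apply/andP; split.
  by apply/semistandardP => c c'; rewrite !ffunE /=; split=> // ->.
apply/eqP/mnmP => i; rewrite contentE mnmE -(sum_row_eq lam).
by apply: eq_bigr => c _; rewrite ffunE.
Qed.

(** * Filling a horizontal strip with a new largest entry *)

Section Branching.

Variables (n : nat) (lam mu : seq nat).
Hypotheses (plam : is_part lam) (pmu : is_part mu) (hs : hstrip lam mu).

Lemma embed_cell_subproof (c' : cell mu) :
  exists c : cell lam, (row_of c == row_of c') && (col_of c == col_of c').
Proof.
have [|c [rc cc]] := @cellP lam (row_of c') (col_of c'); last first.
  by exists c; rewrite rc cc !eqxx.
by have /hstripP/(_ (row_of c'))[le_mu _] := hs; apply: leq_trans (col_of_lt c') le_mu.
Qed.

Definition embed_cell (c' : cell mu) : cell lam := xchoose (embed_cell_subproof c').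

Lemma row_of_embed c' : row_of (embed_cell c') = row_of c'.
Proof. by have /andP[/eqP] := xchooseP (embed_cell_subproof c'). Qed.

Lemma col_of_embed c' : col_of (embed_cell c') = col_of c'.
Proof. by have /andP[_ /eqP] := xchooseP (embed_cell_subproof c'). Qed.

Lemma embed_cell_inj : injective embed_cell.
Proof.
move=> c c' eq_c; apply: cell_inj; first by rewrite -!row_of_embed eq_c.
by rewrite -!col_of_embed eq_c.
Qed.

Variant embed_cell_spec (c : cell lam) : bool -> Prop :=
  | InEmbed c' of c = embed_cell c' : embed_cell_spec c true
  | NotInEmbed of (forall c', embed_cell c' != c) : embed_cell_spec c false.

Lemma embed_cellP c : embed_cell_spec c (col_of c < nth 0 mu (row_of c)).
Proof.
have [c' /eqP <- | out] := pickP (fun c' => embed_cell c' == c).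
  by rewrite row_of_embed col_of_embed col_of_lt; apply: (@InEmbed _ c').
case: (boolP (_ < _)) => [lt_c | _]; last by right=> c'; rewrite out.
have [c' [rc' cc']] := cellP lt_c; suff : embed_cell c' == c by rewrite out.
by apply/eqP/cell_inj; rewrite ?row_of_embed ?col_of_embed.
Qed.

Definition extend (T : {ffun cell mu -> 'I_n}) : {ffun cell lam -> 'I_n.+1} :=
  [ffun c => if [pick c' | embed_cell c' == c] is Some c'
             then widen_ord (leqnSn n) (T c') else ord_max].

Lemma extend_embed T c' : extend T (embed_cell c') = T c' :> nat.
Proof.
rewrite ffunE; case: pickP => [c /eqP/embed_cell_inj-> // | /(_ c')].
by rewrite eqxx.
Qed.

Lemma extend_out T c : (forall c', embed_cell c' != c) -> extend T c = n :> nat.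
Proof. by rewrite ffunE; case: pickP => // c' /eqP <- /(_ c'); rewrite eqxx. Qed.

Lemma extend_lt T c : (extend T c < n) = (col_of c < nth 0 mu (row_of c)).
Proof.
by case: embed_cellP => [c' -> | /(extend_out T)->]; rewrite ?ltnn ?extend_embed ?ltn_ord.
Qed.

Lemma extend_inj : injective extend.
Proof.
move=> T T' eqT; apply/ffunP => c; apply: val_inj => /=.
by rewrite -!extend_embed eqT.
Qed.

(** The new entry is maximal, so rows stay weakly increasing. Columns stay strict because every cell
    above a cell of the strip lies in mu, by interlacing. *)
Lemma semistandard_extend T : semistandard (extend T) = semistandard T.
Proof.
apply/semistandardP/semistandardP => ss c c'.
  have := ss (embed_cell c) (embed_cell c').
  by rewrite !extend_embed !row_of_embed !col_of_embed.
have le_n : extend T c <= n by rewrite -ltnS.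
have [out | [k' def_c']] : (extend T c' = n :> nat) \/ exists k', c' = embed_cell k'.
  by case: (embed_cellP c') => [k' -> | /(extend_out T)]; [right; exists k' | left].
  rewrite out; split=> // eq_col lt_row; rewrite extend_lt eq_col.
  have /hstripP/(_ (row_of c))[_ le_mu] := hs; apply: leq_trans le_mu.
  exact: leq_trans (col_of_lt c') (part_nth_anti plam lt_row).
have embc : (row_of c <= row_of c') -> (col_of c <= col_of c') ->
    exists k, c = embed_cell k.
  rewrite def_c' row_of_embed col_of_embed => le_row le_col.
  have: col_of c < nth 0 mu (row_of c).
    exact: leq_ltn_trans le_col (leq_trans (col_of_lt k') (part_nth_anti pmu le_row)).
  by case: embed_cellP => // k -> _; exists k.
split=> eq_rc lt_rc; have [||k def_c] := embc; try lia;
  move: (ss k k') eq_rc lt_rc;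
  rewrite def_c def_c' !extend_embed !row_of_embed !col_of_embed; case; auto.
Qed.

Lemma content_extend T (i : 'I_n) :
  content (extend T) (widen_ord (leqnSn n) i) = content T i.
Proof.
rewrite !contentE [LHS](bigID (mem (embed_cell @: [set: cell mu]))) /=.
rewrite [X in _ + X]big1 ?addn0 => [|c /imsetP outc].
  rewrite big_imset /=; last by move=> c c' _ _; apply: embed_cell_inj.
  apply: eq_big => [c | c _]; first by rewrite inE.
  by rewrite -!val_eqE /= extend_embed.
rewrite -val_eqE /= extend_out => [|c'].
  by rewrite gtn_eqF.
by apply/eqP => def_c; case: outc; exists c'.
Qed.

(** The exponent of the last variable is forced by the total degree. *)
Lemma content_extend_eq T (m : 'X_{1..n.+1}) : mdeg m = sumn lam ->
  content T = [multinom m (widen_ord (leqnSn n) i) | i < n] ->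
  content (extend T) = m.
Proof.
move=> mdeg_m cT; have widenE (i : 'I_n) :
    content (extend T) (widen_ord (leqnSn n) i) = m (widen_ord (leqnSn n) i).
  by rewrite content_extend cT mnmE.
apply/mnmP => i; have [lt_i | ge_i] := ltnP i n.
  by rewrite (_ : i = widen_ord (leqnSn n) (Ordinal lt_i)) //; apply: val_inj.
have -> : i = ord_max by apply/val_inj/eqP; rewrite eqn_leq ge_i -ltnS ltn_ord.
have := mdeg_content (extend T); rewrite -mdeg_m !mdegE !big_ord_recr /=.
by rewrite (eq_bigr _ (fun i _ => widenE i)) => /addnI.
Qed.

Lemma extend_surj (T : {ffun cell lam -> 'I_n.+1}) :
  (forall c, (T c < n) = (col_of c < nth 0 mu (row_of c))) ->
  exists T', T = extend T'.
Proof.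
move=> ltT; have ltT' c' : T (embed_cell c') < n.
  by rewrite ltT row_of_embed col_of_embed col_of_lt.
exists [ffun c' => Ordinal (ltT' c')]; apply/ffunP => c; apply: val_inj => /=.
have := ltT c; case: embed_cellP => [c' -> _ | out /negbT].
  by rewrite extend_embed ffunE.
by rewrite extend_out // -leqNgt => le_n; apply/eqP; rewrite eqn_leq le_n andbT -ltnS ltn_ord.
Qed.

End Branching.

(** * The shape occupied by the entries other than the largest *)

Section RestrictedShape.

Variables (n : nat) (lam : seq nat) (T : {ffun cell lam -> 'I_n.+1}).
Hypotheses (plam : is_part lam) (ssT : semistandard T).

Definition max_at (i j : nat) : bool :=
  [exists c : cell lam, [&& row_of c == i, col_of c == j & n <= T c]].

(** The column of the first entry [n] in the row. If there is none, [find] returns the length of the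
    row, so in all cases this counts the entries below [n]. *)
Definition below_row (i : nat) : nat := find (max_at i) (iota 0 (nth 0 lam i)).

Lemma below_row_le i : below_row i <= nth 0 lam i.
Proof. by have := find_size (max_at i) (iota 0 (nth 0 lam i)); rewrite size_iota. Qed.

Lemma below_rowP c : (T c < n) = (col_of c < below_row (row_of c)).
Proof.
have lt_c := col_of_lt c; rewrite /below_row; set s := iota _ _.
apply/idP/idP => [lt_n | /(before_find 0)].
  rewrite ltnNge; apply/negP => le_c.
  have : has (max_at (row_of c)) s.
    by rewrite has_find size_iota (leq_ltn_trans le_c).
  move/(nth_find 0); rewrite nth_iota ?(leq_ltn_trans le_c) // add0n.
  case/existsP=> c' /and3P[/eqP rc' /eqP cc' le_n].
  have [eq_c | ne_c] := eqVneq (col_of c') (col_of c).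
    by rewrite (cell_inj rc' eq_c) in le_n; lia.
  have [/(_ rc')] := semistandardP _ ssT c' c; lia.
rewrite nth_iota // => /negbT/existsPn/(_ c); rewrite !eqxx /=; lia.
Qed.

(** Otherwise the column [below_row i] would contain an entry [n] in row [i] and a strictly larger
    one beneath it. *)
Lemma hstrip_below_row i : nth 0 lam i.+1 <= below_row i.
Proof.
rewrite leqNgt; apply/negP => /cellP[c [rc cc]].
have [|c' [rc' cc']] := @cellP lam i (below_row i).
  by rewrite -cc (leq_trans (col_of_lt c)) // rc part_nth_anti.
have [_] := semistandardP _ ssT c' c; rewrite cc cc' rc rc' ltnSn.
move/(_ erefl isT); have := below_rowP c'; have := ltn_ord (T c); rewrite cc' rc'. lia.
Qed.

Definition restricted_shape : seq nat := part_of below_row (size lam).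

Lemma restricted_shapeP :
  [/\ is_part restricted_shape, hstrip lam restricted_shape
    & forall c, (T c < n) = (col_of c < nth 0 restricted_shape (row_of c))].
Proof.
have [||pmu nth_mu] := @part_ofP below_row (size lam).
- by move=> i; apply: leq_trans (below_row_le _) (hstrip_below_row i).
- by apply/eqP; rewrite -leqn0; have := below_row_le (size lam); rewrite nth_default.
split=> // [|c]; last by rewrite nth_mu below_rowP.
by apply/hstripP => i; rewrite nth_mu below_row_le hstrip_below_row.
Qed.

Lemma restricted_shape_uniq mu : is_part mu -> hstrip lam mu ->
  (forall c, (T c < n) = (col_of c < nth 0 mu (row_of c))) ->
  mu = restricted_shape.
Proof.
have [psh hsh ltsh] := restricted_shapeP.
have le_nth nu nu' : hstrip lam nu ->
    (forall c : cell lam, col_of c < nth 0 nu (row_of c)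
                          = (col_of c < nth 0 nu' (row_of c))) ->
    forall i, nth 0 nu i <= nth 0 nu' i.
  move=> /hstripP hnu eq_lt i; rewrite leqNgt; apply/negP => lt_i.
  have [|c [rc cc]] := @cellP lam i (nth 0 nu' i).
    by apply: leq_trans lt_i _; case: (hnu i).
  by have := eq_lt c; rewrite rc cc lt_i ltnn.
move=> pmu hmu ltmu; apply: eq_part => // i; apply/eqP; rewrite eqn_leq.
by rewrite !le_nth // => c; rewrite -ltsh ltmu.
Qed.

End RestrictedShape.

(** The tableaux of shape lam are sorted by [restricted_shape]; the fibre over mu is the image under
    [extend] of the tableaux of shape mu. *)
Lemma schur_branching (R : comNzRingType) n lam (m : 'X_{1..n.+1})
    (m' := [multinom m (widen_ord (leqnSn n) i) | i < n]) :
  is_part lam -> sumn lam = mdeg m ->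
  ((schur R n.+1 lam)@_m
   = \sum_(mu <- partitions_of (mdeg m') | hstrip lam mu) (schur R n mu)@_m')%R.
Proof.
move=> plam sum_lam; rewrite schur_mcoeff; set A := [set T | _].
have cardA mu : is_part mu -> sumn mu = mdeg m' -> hstrip lam mu ->
    (schur R n mu)@_m' = (\sum_(T in A) (restricted_shape T == mu))%:R%R.
  move=> pmu sum_mu hmu; rewrite schur_mcoeff; congr (_%:R)%R.
  rewrite -(card_imset _ (@extend_inj n _ _ hmu)).
  transitivity #|[set T in A | restricted_shape T == mu]|; last first.
    by rewrite -sum1dep_card big_mkcondr; apply: eq_bigr => T _; case: eqP.
  apply: eq_card => T; rewrite !inE; apply/imsetP/andP.
    case=> T'; rewrite inE => /andP[ssT' /eqP cT'] ->; split.
      rewrite semistandard_extend // ssT' /=; exact/eqP/content_extend_eq.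
    rewrite eq_sym; apply/eqP/restricted_shape_uniq => // [|c]; last exact: extend_lt.
    by rewrite semistandard_extend.
  case=> /andP[ssT /eqP cT] /eqP def_mu.
  have [_ _ ltT] := restricted_shapeP plam ssT; rewrite def_mu in ltT.
  have [T' def_T] := extend_surj hmu ltT; exists T' => //.
  rewrite inE -(semistandard_extend plam pmu hmu) -def_T ssT /=.
  by apply/eqP/mnmP => i; rewrite -(content_extend hmu) -def_T cT mnmE.
have inA T : T \in A ->
    restricted_shape T \in partitions_of (mdeg m') /\ hstrip lam (restricted_shape T).
  rewrite inE => /andP[ssT /eqP cT]; have [psh hsh ltT] := restricted_shapeP plam ssT.
  have [T' def_T] := extend_surj hsh ltT.
  rewrite mem_partitions_of psh -(mdeg_content T'); split=> //; apply/eqP; congr mdeg.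
  by apply/mnmP => i; rewrite -(content_extend hsh) -def_T cT mnmE.
rewrite big_seq_cond (eq_bigr (fun mu =>
    (\sum_(T in A) (restricted_shape T == mu))%:R%R)); last first.
  by move=> mu /andP[]; rewrite mem_partitions_of => /andP[pmu /eqP]; apply: cardA.
rewrite -big_seq_cond -natr_sum exchange_big -sum1_card; congr (_%:R)%R.
apply: eq_bigr => T /inA[r_sh hs_sh].
rewrite big_mkcond (bigD1_seq (restricted_shape T)) ?partitions_of_uniq //=.
rewrite hs_sh eqxx big1 // => mu; rewrite eq_sym => /negbTE->; exact: if_same.
Qed.

End Tableaux.

(** * Schur expansions *)

Section Expansion.
Variables (R : comNzRingType) (f : nat -> R).

(** In the coefficient of x^nu, a partition other than nu contributes only if its [row_sum] is
    smaller, so induction on [row_sum] isolates [s nu]. *)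
Lemma schur_expansion_uniq (s s' : seq nat -> R) :
  is_schur_expansion f s -> is_schur_expansion f s' ->
  forall lam, is_part lam -> s lam = s' lam.
Proof.
move=> exp_s exp_s' lam; have [N] := ubnP (row_sum lam); elim: N lam => // N IHN nu.
rewrite ltnS => le_N pnu; have := exp_s _ (part_mnm nu); rewrite exp_s' => /eqP.
have nu_in : nu \in partitions_of (mdeg (part_mnm nu)).
  by rewrite mem_partitions_of pnu mdeg_part_mnm eqxx.
rewrite -subr_eq0 -sumrB (bigD1_seq nu) ?partitions_of_uniq //=.
rewrite schur_triangular // eqxx !mulr1 big_seq_cond big1 ?addr0 => [|lam].
  by rewrite subr_eq0 => /eqP.
rewrite mem_partitions_of => /andP[/andP[plam _] /negbTE ne_lam]; rewrite -mulrBl.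
have [lt_lam | ge_lam] := ltnP (row_sum lam) (row_sum nu).
  by rewrite IHN ?subrr ?mul0r //; apply: leq_trans le_N.
by rewrite schur_triangular // ne_lam mulr0.
Qed.

(** Says that the linear map sending s_lam to [s lam] turns multiplication by h_m into
    multiplication by [f m]. *)
Definition pieri_rule (s : seq nat -> R) : Prop :=
  forall mu m, is_part mu ->
    \sum_(lam <- partitions_of (sumn mu + m) | hstrip lam mu) s lam = f m * s mu.

(* Induction on the number of variables: the last variable contributes a      *)
(* horizontal strip to each tableau.                                          *)
Lemma schur_expansion_of_pieri (s : seq nat -> R) :
  s [::] = 1 -> pieri_rule s -> is_schur_expansion f s.
Proof.
move=> s_nil pieri; elim=> [|n IHn] m.
  rewrite big_ord0 mdegE big_ord0.
  have -> : partitions_of 0 = [:: [::]].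
    apply: perm_small_eq => //; apply: uniq_perm; rewrite ?partitions_of_uniq //.
    move=> lam; rewrite mem_partitions_of inE; apply/andP/eqP => [[] | -> //].
    by case: lam => // [[|x] lam] /andP[].
  rewrite big_seq1 s_nil mul1r; have -> : m = part_mnm [::] by apply/mnmP; case.
  by rewrite (schur_triangular R (lam := [::]) (nu := [::])).
pose m' := [multinom m (widen_ord (leqnSn n) i) | i < n].
have mdeg_m : mdeg m = (mdeg m' + m ord_max)%N.
  rewrite !mdegE big_ord_recr; congr (_ + _)%N.
  by apply: eq_bigr => i _; rewrite mnmE.
rewrite big_ord_recr /= (eq_bigr (fun i => f (m' i))); last first.
  by move=> i _; rewrite mnmE.
rewrite IHn big_distrl /=.
transitivity (\sum_(lam <- partitions_of (mdeg m))
  \sum_(mu <- partitions_of (mdeg m') | hstrip lam mu) s lam * (schur R n mu)@_m').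
  rewrite (exchange_big_dep xpredT) //= big_seq [RHS]big_seq.
  apply: eq_bigr => mu; rewrite mem_partitions_of => /andP[pmu /eqP sum_mu].
  by rewrite -big_distrl mdeg_m -sum_mu pieri //=; ring.
rewrite big_seq [RHS]big_seq; apply: eq_bigr => lam.
rewrite mem_partitions_of => /andP[plam /eqP sum_lam].
by rewrite schur_branching // -big_distrr.
Qed.

End Expansion.

(** * Reindexing sums and expanding determinants by rows *)

Section BigReindex.

Lemma big_seq_reindex (V : nmodType) (T : eqType) (I : finType) (r : seq T)
    (P : pred T) (Q : pred I) (phi : T -> I) (F : T -> V) (F' : I -> V) :
    uniq r ->
    {in [pred x | (x \in r) && P x] &, injective phi} ->
    (forall x, x \in r -> P x -> Q (phi x) /\ F x = F' (phi x)) ->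
    (forall i, Q i -> exists x, [/\ x \in r, P x & phi x = i]) ->
  \sum_(x <- r | P x) F x = \sum_(i | Q i) F' i.
Proof.
move=> uniq_r inj_phi phiP surj_phi.
rewrite -big_filter big_seq (eq_bigr (F' \o phi)) => [|x]; last first.
  by rewrite mem_filter => /andP[Px xr]; case: (phiP x).
rewrite -big_seq -(big_map phi xpredT) -[RHS]big_filter.
apply: perm_big; apply: uniq_perm; last 1 first.
- move=> i; rewrite mem_filter mem_index_enum andbT; apply/mapP/idP => [[x] | Qi].
    by rewrite mem_filter => /andP[Px xr] ->; case: (phiP x).
  by have [x [xr Px <-]] := surj_phi _ Qi; exists x; rewrite // mem_filter Px.
- rewrite map_inj_in_uniq ?filter_uniq // => x y; rewrite !mem_filter.
  by move=> /andP[Px xr] /andP[Py yr]; apply: inj_phi; rewrite inE ?xr ?yr.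
- by rewrite filter_uniq // index_enum_uniq.
Qed.

Lemma det_sum_rows (R : comPzRingType) (I : finType) n (P : 'I_n -> pred I)
    (A : 'I_n -> 'I_n -> I -> R) :
  \det (\matrix_(i, j) \sum_(k | P i k) A i j k)
  = \sum_(g : {ffun 'I_n -> I} | [forall i, P i (g i)]) \det (\matrix_(i, j) A i j (g i)).
Proof.
rewrite exchange_big; apply: eq_bigr => s _; rewrite -mulr_sumr; congr (_ * _).
rewrite (eq_bigr (fun i => \sum_(k | P i k) A i (s i) k)) => [|i _]; last by rewrite mxE.
rewrite bigA_distr_big_dep; apply: eq_big => [g | g _].
  by apply/familyP/forallP.
by apply: eq_bigr => i _; rewrite mxE.
Qed.

End BigReindex.

(** * Jacobi-Trudi determinants *)

Lemma det_last_row (R : comNzRingType) n (A : 'M[R]_n.+1) :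
  (forall j, A ord_max (lift ord_max j) = 0) ->
  \det A = A ord_max ord_max * \det (\matrix_(i, j) A (lift ord_max i) (lift ord_max j)).
Proof.
move=> A0; rewrite (expand_det_row A ord_max) (bigD1 ord_max) //= big1 => [|j].
  rewrite addr0 /cofactor -signr_odd addnn odd_double mul1r; congr (_ * \det _).
  by apply/matrixP => i j; rewrite !mxE.
by case: (unliftP ord_max j) => [j' -> _ | -> /eqP//]; rewrite A0 mul0r.
Qed.

Lemma det_scale_rows (R : comNzRingType) n (c : 'I_n -> R) (A : 'M[R]_n) :
  \det (\matrix_(i, j) (c i * A i j)) = (\prod_i c i) * \det A.
Proof.
have -> : \matrix_(i, j) (c i * A i j) = diag_mx (\row_i c i) *m A.
  by apply/matrixP => i j; rewrite mul_diag_mx !mxE.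
by rewrite det_mulmx det_diag; congr (_ * _); apply: eq_bigr => i _; rewrite mxE.
Qed.

Section JacobiTrudi.
Variables (R : comNzRingType) (f : nat -> R).

Lemma coefz_lt0 k : k < 0 -> coefz f k = 0.
Proof. by case: k. Qed.

Lemma det_polyC (n : nat) (A : 'M[R]_n) : (\det A)%:P = \det (map_mx polyC A).
Proof. by rewrite det_map_mx. Qed.

Definition jacobi_trudi (n : nat) (lam : seq nat) : R :=
  \det (\matrix_(i < n, j < n) coefz f ((nth 0%N lam i)%:Z - i%:Z + j%:Z)).

Hypothesis f0 : f 0%N = 1.

(** A zero part adds a last row 0, ..., 0, f_0 with f_0 = 1. This lets all strips over mu share one
    matrix size, one more than the length of mu. *)
Lemma jacobi_trudi_stable n lam :
  (size lam <= n)%N -> jacobi_trudi n lam = jacobi_trudi (size lam) lam.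
Proof.
move/subnK<-; elim: (n - size lam)%N => // k IHk; rewrite addSn -IHk.
rewrite {1}/jacobi_trudi det_last_row => [|j]; rewrite !mxE /= nth_default ?leq_addl //.
  rewrite (_ : _ + _ = 0); last by lia.
  rewrite [coefz f 0]f0 mul1r.
  by rewrite /jacobi_trudi; congr (\det _); apply/matrixP => i j; rewrite !mxE !lift_max.
by have /= lt_j := ltn_ord j; rewrite coefz_lt0 // /bump; lia.
Qed.

Variable d : nat.
Hypothesis f_gt : forall k, (d < k)%N -> f k = 0.

Section RowSums.
Variables (n B : nat) (mu : seq nat).
Hypotheses (pmu : is_part mu) (size_mu : size mu = n).
Hypotheses (ltB : (n + d < B)%N) (leB : (nth 0%N mu 0%N + n <= B)%N).

(** With the beta number x = lam_i + n - i, the entry f_(lam_i - i + j) depends only on x and j. *)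
Definition row_entry (x : nat) (j : 'I_n.+1) : R := coefz f (x%:Z - (n - j)%:Z).

Definition strip_lo (i : nat) : nat := (nth 0%N mu i + (n - i))%N.
(** The bound lam_i <= mu_(i-1) is strict in terms of beta numbers, since n - i drops by one from
    row to row. Row 0 is bounded only by the cutoff [B]. *)
Definition strip_hi (i : nat) : nat := if i is i'.+1 then strip_lo i' else B.

Let tail (i : nat) (j : 'I_n.+1) : {poly R} :=
  \sum_(x < B | (strip_lo i <= x)%N) (row_entry x j)%:P * 'X^x.

Let strip_mx : 'M[{poly R}]_n.+1 :=
  \matrix_(i, j) \sum_(x < B | (strip_lo i <= x < strip_hi i)%N) (row_entry x j)%:P * 'X^x.

Let tail_mx : 'M[{poly R}]_n.+1 := \matrix_(i, j) tail i j.

Let lo_anti i : (strip_lo i.+1 <= strip_lo i)%N.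
Proof. by rewrite /strip_lo; have := part_nth_anti pmu (leqnSn i); lia. Qed.

(** Subtracts from each row the one above it: the sum over an interval is a difference of two
    tails. *)
Let row_op : 'M[{poly R}]_n.+1 := \matrix_(i, k) ((i == k)%:R - (i == k.+1 :> nat)%:R).

Let col_op : 'M[{poly R}]_n.+1 := \matrix_(k, j) ((k == j)%:R - (k == j.+1 :> nat)%:R * 'X).

Let det_row_op : \det row_op = 1.
Proof.
rewrite det_trig; last first.
  apply/is_trig_mxP => i j lt_ij; rewrite mxE -val_eqE /= ltn_eqF // ltn_eqF ?subr0 //.
  exact: ltnW.
by apply: big1 => i _; rewrite mxE eqxx ltn_eqF // subr0.
Qed.

Let det_col_op : \det col_op = 1.
Proof.
rewrite det_trig; last first.
  apply/is_trig_mxP => i j lt_ij; rewrite mxE -val_eqE /= ltn_eqF // ltn_eqF ?mul0r ?subr0 //.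
  exact: ltnW.
by apply: big1 => i _; rewrite mxE eqxx ltn_eqF // mul0r subr0.
Qed.

Let strip_mxE : strip_mx = row_op *m tail_mx.
Proof.
apply/matrixP => i j; apply/esym; rewrite !mxE.
rewrite (eq_bigr (fun k : 'I_n.+1 => (i == k)%:R * tail k j
                               - (i == k.+1 :> nat)%:R * tail k j)); last first.
  by move=> k _; rewrite !mxE mulrBl.
rewrite sumrB (bigD1 i) //= eqxx mul1r big1 ?addr0 => [|k]; last first.
  by rewrite eq_sym => /negbTE->; rewrite mul0r.
case: i => [[|i] lt_i] /=.
  rewrite big1 ?subr0 => [|k _]; last by rewrite mul0r.
  by apply: eq_bigl => x; rewrite ltn_ord andbT.
rewrite (bigD1 (Ordinal (ltnW lt_i))) //= eqxx mul1r big1 ?addr0 => [|k]; last first.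
  by rewrite -val_eqE /= eqSS eq_sym => /negbTE->; rewrite mul0r.
rewrite /tail (bigID (fun x : 'I_B => strip_lo i <= x)%N) /=.
rewrite (eq_bigl (fun x : 'I_B => strip_lo i <= x)%N) => [|x].
  by rewrite addrAC subrr add0r; apply: eq_bigl => x; rewrite -ltnNge.
by apply: andb_idl => /(leq_trans (lo_anti i)).
Qed.

(** Moving one column to the right has the same effect on [row_entry] as raising x by 1, so the
    difference telescopes; the term at [B] vanishes because its index exceeds [d]. *)
Let tail_col i (j j' : 'I_n.+1) : j' = j.+1 :> nat -> (i <= n)%N ->
  tail i j - 'X * tail i j' = (row_entry (strip_lo i) j)%:P * 'X^(strip_lo i).
Proof.
move=> def_j' le_i; pose h x : {poly R} := (row_entry x j)%:P * 'X^x.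
have le_lo : (strip_lo i <= B)%N.
  by apply: leq_trans leB; rewrite /strip_lo leq_add ?leq_subr ?part_nth_anti.
have hB : h B = 0.
  rewrite /h /row_entry subzn; last by lia.
  by rewrite [coefz _ _]f_gt ?mul0r //; lia.
have -> : tail i j = \sum_(strip_lo i <= x < B) h x.
  by rewrite (big_geq_mkord _ _ xpredT).
have -> : 'X * tail i j' = \sum_(strip_lo i <= x < B) h x.+1.
  rewrite (big_geq_mkord _ _ xpredT) big_distrr; apply: eq_bigr => x _ /=.
  rewrite mulrCA -exprS; congr (_%:P * _); congr coefz; rewrite def_j'.
  by have := ltn_ord j'; lia.
by rewrite -[LHS]opprB -sumrB telescope_sumr // hB sub0r opprK.
Qed.

Let last_entry : tail n ord_max = \sum_(x < B) (f x)%:P * 'X^x.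
Proof.
rewrite /tail; apply: eq_big => [x | x _].
  by rewrite /strip_lo nth_default ?size_mu // subnn.
by congr (_%:P * _); rewrite /row_entry /= subnn subr0.
Qed.

(** After the column operation all columns but the last hold single terms. The last row has beta
    number 0, hence entries f_(j-n), zero except in the corner, where F(X) appears; the
    complementary minor is the determinant for mu with row i scaled by a power of X. *)
Let det_tail : \det tail_mx =
  (\sum_(x < B) (f x)%:P * 'X^x) * ((\prod_(i < n) 'X^(strip_lo i)) * (jacobi_trudi n mu)%:P).
Proof.
rewrite -[LHS]mulr1 -[X in _ * X = _]det_col_op -det_mulmx.
have mulE i j : (tail_mx *m col_op) i j
    = if unlift ord_max j is Some _ then (row_entry (strip_lo i) j)%:P * 'X^(strip_lo i)
      else tail i j.
  rewrite !mxE (eq_bigr (fun k : 'I_n.+1 => (k == j)%:R * tail i k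
       - (k == j.+1 :> nat)%:R * ('X * tail i k))); last first.
    by move=> k _; rewrite !mxE; ring.
  rewrite sumrB (bigD1 j) //= eqxx mul1r big1 ?addr0 => [|k /negbTE->]; last first.
    by rewrite mul0r.
  case: unliftP => [j' def_j | def_j].
    have lt_j : (j.+1 < n.+1)%N by rewrite def_j lift_max; apply: ltn_ord.
    rewrite (bigD1 (Ordinal lt_j)) //= eqxx mul1r big1 ?addr0 => [|k].
      by apply: tail_col => //; rewrite -ltnS.
    by rewrite -val_eqE /= => /negbTE->; rewrite mul0r.
  rewrite big1 ?subr0 // => k _; rewrite def_j /= ltn_eqF ?mul0r //.
rewrite det_last_row => [|j]; rewrite !mulE ?liftK ?unlift_none.
  rewrite last_entry; congr (_ * _).
  rewrite (_ : jacobi_trudi n mu = \det (\matrix_(i < n, j < n)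
      row_entry (strip_lo i) (lift ord_max j))).
    rewrite det_polyC -(det_scale_rows (fun i : 'I_n => 'X^(strip_lo i))); congr (\det _).
    by apply/matrixP => i j; rewrite [LHS]mxE mulE liftK !mxE lift_max mulrC.
  congr (\det _); apply/matrixP => i j; rewrite !mxE /row_entry /strip_lo lift_max.
  by congr coefz; have := ltn_ord i; have := ltn_ord j; lia.
rewrite /row_entry coefz_lt0 ?mul0r // lift_max /strip_lo nth_default ?size_mu //=.
by have /= := ltn_ord j; lia.
Qed.

Lemma jacobi_trudi_strips :
  \sum_(g : {ffun 'I_n.+1 -> 'I_B} | [forall i : 'I_n.+1, (strip_lo i <= g i < strip_hi i)%N])
     (\prod_i 'X^(g i)) * (\det (\matrix_(i, j) row_entry (g i) j))%:P
  = (\sum_(x < B) (f x)%:P * 'X^x) * ((\prod_(i < n) 'X^(strip_lo i)) * (jacobi_trudi n mu)%:P).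
Proof.
rewrite -det_tail -[RHS]mul1r -[X in _ = X * _]det_row_op -det_mulmx -strip_mxE /strip_mx.
rewrite (det_sum_rows (fun (i : 'I_n.+1) (x : 'I_B) => (strip_lo i <= x < strip_hi i)%N)
  (fun (i j : 'I_n.+1) (x : 'I_B) => (row_entry x j)%:P * 'X^x)).
apply: eq_bigr => g _.
rewrite det_polyC -(det_scale_rows (fun i : 'I_n.+1 => 'X^(g i))); congr (\det _).
by apply/matrixP => i j; rewrite !mxE mulrC.
Qed.
End RowSums.

Lemma jacobi_trudi_row_entry n lam :
  jacobi_trudi n.+1 lam
  = \det (\matrix_(i < n.+1, j < n.+1) row_entry (nth 0%N lam i + (n - i))%N j).
Proof.
congr (\det _); apply/matrixP => i j; rewrite !mxE; congr coefz.
by have := ltn_ord i; have := ltn_ord j; lia.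
Qed.

(** A coefficient of [jacobi_trudi_strips], strips being identified with their vectors of beta
    numbers. *)
Lemma jacobi_trudi_pieri : pieri_rule f (fun lam => jacobi_trudi (size lam) lam).
Proof.
(* [B] exceeds every beta number lam_i + n - i with |lam| = |mu| + m, and also n + d. *)
move=> mu m pmu; set n := size mu; set B := (sumn mu + m + n + d).+1.
have sum_ge lam : (nth 0%N lam 0%N <= sumn lam)%N by case: lam => //= *; apply: leq_addr.
have le_sum lam i : is_part lam -> (nth 0%N lam i <= sumn lam)%N.
  by move=> plam; apply: leq_trans (part_nth_anti plam (leq0n i)) (sum_ge _).
have ltB : (n + d < B)%N by rewrite /B; lia.
have leB : (nth 0%N mu 0%N + n <= B)%N by have := sum_ge mu; rewrite /B; lia.
(* The sum of the n + 1 beta numbers of a lam of size |mu| + m; row [n] of mu would add 0. *)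
pose K := (m + \sum_(i < n) strip_lo n mu i)%N.
have := jacobi_trudi_strips pmu erefl ltB leB; move/(congr1 (coefp K)); rewrite /coefp.
have -> : ((\sum_(x < B) (f x)%:P * 'X^x) *
    ((\prod_(i < n) 'X^(strip_lo n mu i)) * (jacobi_trudi n mu)%:P))`_K
    = f m * jacobi_trudi n mu.
  rewrite prodrXr mulrCA coefXnM /K ltnNge leq_addl /= addnK coefMC; congr (_ * _).
  rewrite coef_sum (bigD1 (inord m)) //= coefCM coefXn inordK ?eqxx ?mulr1; last first.
    by rewrite /B; lia.
  rewrite big1 ?addr0 // => x; rewrite -val_eqE /= inordK; last by rewrite /B; lia.
  by rewrite coefCM coefXn eq_sym => /negbTE->; rewrite mulr0.
move=> <-; rewrite coef_sum.
pose row_val lam : {ffun 'I_n.+1 -> 'I_B} := [ffun i : 'I__ => inord (nth 0%N lam i + (n - i))].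
have row_valE lam i : is_part lam -> sumn lam = (sumn mu + m)%N ->
    row_val lam i = (nth 0%N lam i + (n - i))%N :> nat.
  by move=> plam sum_lam; rewrite ffunE inordK // /B; have := le_sum lam i plam; lia.
have sum_row lam : is_part lam -> sumn lam = (sumn mu + m)%N -> (size lam <= n.+1)%N ->
    (\sum_i row_val lam i)%N = K.
  move=> plam sum_lam size_lam; rewrite (eq_bigr _ (fun i _ => row_valE lam i plam sum_lam)).
  rewrite big_split -(sumn_nth size_lam) sum_lam /K big_split -(sumn_nth (leqnn _)).
  by rewrite /= big_ord_recr /= subnn addn0; lia.
have size_hs lam : is_part lam -> hstrip lam mu -> (size lam <= n.+1)%N.
  move=> plam /hstripP/(_ n)[_]; rewrite [nth 0%N mu n]nth_default // => le0.
  by rewrite leqNgt -part_nth_gt0 // -leqNgt.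
rewrite [RHS](bigID (fun g : {ffun 'I_n.+1 -> 'I_B} => (\sum_i g i)%N == K)) /=.
rewrite [X in _ = _ + X]big1 ?addr0 => [|g /andP[_ ne_K]]; last first.
  by rewrite prodrXr coefMC coefXn eq_sym (negbTE ne_K) mul0r.
apply: (big_seq_reindex (phi := row_val)); first exact: partitions_of_uniq.
- move=> lam lam'; rewrite !inE !mem_partitions_of.
  move=> /andP[/andP[plam /eqP sum_lam] hs] /andP[/andP[plam' /eqP sum_lam'] hs'] eq_row.
  apply: eq_part => // i; have [lt_i | ge_i] := ltnP i n.+1; last first.
    by rewrite !nth_default // (leq_trans (size_hs _ _ _)).
  have := row_valE lam (Ordinal lt_i) plam sum_lam.
  by rewrite eq_row row_valE //= => /addIn.
- move=> lam; rewrite mem_partitions_of => /andP[plam /eqP sum_lam] hs.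
  have size_lam := size_hs _ plam hs; rewrite sum_row // eqxx andbT; split.
    apply/forallP => i; rewrite row_valE // /strip_lo leq_add2r.
    have /hstripP hs_lam := hs; have [-> _] /= := hs_lam i.
    rewrite -(row_valE _ i plam) //.
    case: i => [[|i] lt_i] /=; first exact: ltn_ord.
    by rewrite row_valE //= /strip_lo; have [_] := hs_lam i; lia.
  rewrite prodrXr sum_row // coefMC coefXn eqxx mul1r.
  rewrite -(jacobi_trudi_stable size_lam) jacobi_trudi_row_entry; congr (\det _).
  by apply/matrixP => i j; rewrite !mxE row_valE.
- move=> g /andP[/forallP g_range /eqP sum_g].
  (* The inverse map recovers the parts from the beta numbers. *)
  pose part_row i := if (i < n.+1)%N then (g (inord i) - (n - i))%N else 0%N.
  have g_lo i : (i < n.+1)%N -> (nth 0%N mu i + (n - i) <= g (inord i))%N.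
    by move=> lt_i; have /andP[+ _] := g_range (inord i); rewrite inordK.
  have g_hi i : (i < n)%N -> (g (inord i.+1) < nth 0%N mu i + (n - i))%N.
    by move=> lt_i; have /andP[_ +] := g_range (inord i.+1); rewrite inordK.
  have [||plam lamE] := @part_ofP part_row n.+1.
  - move=> i; rewrite /part_row; case: ltnP => // lt_i; rewrite (ltnW lt_i).
    have := g_hi i lt_i; have := g_lo i (ltnW lt_i); lia.
  - by rewrite /part_row ltnn.
  set lam := part_of part_row n.+1 in plam lamE; exists lam.
  have size_lam : (size lam <= n.+1)%N.
    by rewrite leqNgt -part_nth_gt0 // lamE /part_row ltnn.
  have row_g (i : 'I_n.+1) : (nth 0%N lam i + (n - i))%N = g i.
    rewrite lamE /part_row ltn_ord inord_val subnK //.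
    have := g_lo i (ltn_ord i); rewrite inord_val; lia.
  have sum_lam : sumn lam = (sumn mu + m)%N.
    have : (\sum_(i < n.+1) (nth 0%N lam i + (n - i)))%N = K.
      by rewrite -sum_g; apply: eq_bigr => i _.
    rewrite big_split -(sumn_nth size_lam) /K big_split -(sumn_nth (leqnn _)).
    by rewrite /= big_ord_recr /= subnn addn0; lia.
  split; first by rewrite mem_partitions_of plam sum_lam eqxx.
    apply/hstripP => i; rewrite !lamE /part_row; split.
      case: ltnP => [lt_i | ge_i]; last by rewrite nth_default // ltnW.
      by have := g_lo i lt_i; lia.
    by case: ltnP => // lt_i; have := g_hi i lt_i; lia.
  by apply/ffunP => i; apply: val_inj; rewrite /= row_valE // row_g.
Qed.

End JacobiTrudi.

(** * Cyclic determinants *)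

Section CyclicDeterminant.
Variable d : nat.
Implicit Type a : nat -> nat.

Definition shift_mx : 'M[int]_d.+1 := \matrix_(i, c) (c == i.+1 %% d.+1 :> nat)%N%:R.

Lemma char_poly_shift_mx : char_poly shift_mx = 'X^(d.+1) - 1.
Proof.
have monic_p : ('X^(d.+1) - 1 : {poly int}) \is monic by apply: monicXnsubC.
(* A companion matrix has dimension [(size p).-1]; stating the claim for a free [n] allows
   substitution in the type. *)
suff companionE n (A : 'M[int]_n) (p : {poly int}) : p \is monic ->
    n = (size p).-1 ->
    (forall i j, A i j = if i == n.-1 :> nat then - p`_j else (i.+1 == j :> nat)%:R) ->
    char_poly A = p.
  apply: companionE => // [|i c]; first by rewrite size_XnsubC.
  rewrite mxE coefB coefXn coefC (ltn_eqF (ltn_ord c)) add0r opprK /=.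
  have [i_d | ne_i] := eqVneq (i : nat) d; first by rewrite i_d modnn; case: eqP.
  by rewrite modn_small 1?eq_sym // ltnS ltn_neqAle ne_i -ltnS ltn_ord.
move=> p_monic def_n; subst n => defA.
rewrite -[RHS](companionmxK p_monic); congr char_poly.
by apply/matrixP => i j; rewrite defA mxE.
Qed.

(* Row 0 is the eigenvector of the cyclic shift for the eigenvalue 1.         *)
Definition cyclic_mx a : 'M[int]_d.+1 :=
  \matrix_(i, c) if i == 0%N :> nat then 1 else (c == a i.-1 %% d.+1 :> nat)%N%:R.

Lemma eq_cyclic_mx a a' : (forall j, (j < d)%N -> a j = a' j) -> cyclic_mx a = cyclic_mx a'.
Proof.
move=> eq_a; apply/matrixP => -[[|i] lt_i] c; rewrite !mxE //=.
by rewrite eq_a.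
Qed.

Lemma det_cyclic_mx_eq0 a i j : (i < j < d)%N -> (a i = a j %[mod d.+1])%N ->
  \det (cyclic_mx a) = 0.
Proof.
move=> /andP[lt_ij lt_j] eq_a.
have lt_i1 : (i.+1 < d.+1)%N by apply: leq_ltn_trans lt_ij _; apply: ltnW.
apply: (determinant_alternate (i1 := Ordinal lt_i1) (i2 := Ordinal (lt_j : j.+1 < d.+1)%N)).
  by rewrite -val_eqE /= eqSS ltn_eqF.
by move=> c; rewrite !mxE /= eq_a.
Qed.

Lemma sum_unit_row (R : pzSemiRingType) n k :
  \sum_(c < n.+1) (c == k %% n.+1 :> nat)%N%:R = 1 :> R.
Proof.
rewrite (bigD1 (Ordinal (ltn_pmod k (ltn0Sn n)))) //= eqxx big1 ?addr0 // => c.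
by rewrite -val_eqE => /negbTE /= ->.
Qed.

Lemma shift_row_sum (c : 'I_d.+1) : \sum_i shift_mx i c = 1.
Proof.
rewrite -(sum_unit_row _ d (c + d)%N); apply: eq_bigr => i _; rewrite mxE; congr (_%:R).
congr nat_of_bool; apply/eqP/eqP => [-> | ->].
  by rewrite modnDml addSnnS modnDr modn_small.
by rewrite -[(_ %% _).+1%N]addn1 modnDml -addnA addn1 modnDr modn_small.
Qed.

(** The coefficients in X e_a - e_(a+1), the unit row e_a times X minus the cyclic shift; [b] tells
    whether the index is raised. *)
Definition shift_sign (b : bool) : {poly int} := (-1) ^+ b * 'X^(~~ b).

(** The row of ones is scaled by X - 1 and each unit row splits in two. Row 0 is written as a sum
    over the single value [false], so that [det_sum_rows] applies to all rows at once. *)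
Lemma mul_cyclic_mx a i c :
  (map_mx polyC (cyclic_mx a) *m char_poly_mx shift_mx) i c
  = (if i == 0%N :> nat then 'X - 1 else 1)
    * \sum_(b | (i == 0%N :> nat) ==> ~~ b)
        (if i == 0%N :> nat then 1 else shift_sign b)
        * (cyclic_mx (fun j => a j + b)%N i c)%:P.
Proof.
have row_shift : (0 < i)%N ->
    (cyclic_mx a *m shift_mx) i c = cyclic_mx (fun j => a j + 1)%N i c.
  case: i => [[|i] lt_i] // _; rewrite !mxE /=.
  rewrite (bigD1 (Ordinal (ltn_pmod (a i) (ltn0Sn d)))) //= !mxE /= eqxx mul1r.
  rewrite big1 ?addr0 => [|k]; first by rewrite -[(_ %% _).+1%N]addn1 modnDml.
  by rewrite -val_eqE /= !mxE /= => /negbTE->; rewrite mul0r.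
rewrite /char_poly_mx mulmxBr mul_mx_scalar -map_mxM.
set M := _ *m shift_mx; set C := cyclic_mx a.
have -> : ('X *: map_mx polyC C - map_mx polyC M) i c = 'X * (C i c)%:P - (M i c)%:P.
  by rewrite !mxE.
rewrite {}/M {}/C.
case: (posnP i) => [i0 | i_gt0].
  rewrite /= (big_pred1 false) => [|b]; last by case: b.
  have ones a' k : cyclic_mx a' i k = 1 by rewrite mxE i0.
  rewrite [X in _ - X%:P]mxE (eq_bigr (fun k => shift_mx k c)) => [|k _]; last first.
    by rewrite ones mul1r.
  by rewrite shift_row_sum !ones polyC1 mul1r !mulr1.
rewrite /= mul1r big_bool /shift_sign row_shift //= expr1 expr0 mulr1 mulN1r addrC.
congr (_ + _); rewrite mul1r expr1; congr (_ * _%:P); congr (fun_of_matrix _ i c).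
by apply: eq_cyclic_mx => k _; rewrite addn0.
Qed.

(** Two evaluations of the determinant of [cyclic_mx a] times the characteristic matrix:
    multiplicativity gives X^(d+1) - 1, expansion by rows gives X - 1 times the left side.
    Cancelling X - 1 leaves the geometric sum. *)
Lemma det_cyclic_mx_shifts a :
  \sum_(g : {ffun 'I_d.+1 -> bool} | ~~ g ord0)
     (\prod_(i < d) shift_sign (g (lift ord0 i)))
     * (\det (cyclic_mx (fun j => a j + g (inord j.+1))%N))%:P
  = (\sum_(i < d.+1) 'X^i) * (\det (cyclic_mx a))%:P.
Proof.
have X1_neq0 : 'X - 1 != 0 :> {poly int} by rewrite -polyC1 polyXsubC_eq0.
apply: (mulfI X1_neq0); rewrite [RHS]mulrA -subrX1 -char_poly_shift_mx [RHS]mulrC.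
rewrite det_polyC -det_mulmx.
have -> : map_mx polyC (cyclic_mx a) *m char_poly_mx shift_mx
    = \matrix_(i, c) ((if i == 0%N :> nat then 'X - 1 else 1)
        * (\matrix_(i, c) \sum_(b | (i == 0%N :> nat) ==> ~~ b)
             (if i == 0%N :> nat then 1 else shift_sign b)
             * (cyclic_mx (fun j => a j + b)%N i c)%:P) i c).
  by apply/matrixP => i c; rewrite mul_cyclic_mx !mxE.
rewrite (det_scale_rows (fun i : 'I__ => if i == 0%N :> nat then 'X - 1 else 1)).
rewrite big_ord_recl [X in _ = _ * X * _]big1 ?mulr1 //=; congr (_ * _).
rewrite (det_sum_rows (fun (i : 'I_d.+1) b => (i == 0%N :> nat) ==> ~~ b)
  (fun (i c : 'I_d.+1) b => (if i == 0%N :> nat then 1 else shift_sign b)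
             * (cyclic_mx (fun j => a j + b)%N i c)%:P)).
apply: eq_big => [g | g _].
  apply/idP/forallP => [g0 i | /(_ ord0) //]; apply/implyP => /eqP i0.
  by rewrite (_ : i = ord0) //; apply: val_inj.
have <- : \prod_(i < d.+1) (if i == 0%N :> nat then 1 else shift_sign (g i))
    = \prod_(i < d) shift_sign (g (lift ord0 i)).
  by rewrite big_ord_recl /= mul1r.
rewrite det_polyC -(det_scale_rows (fun i : 'I_d.+1 => if i == 0%N :> nat then 1 else _)).
congr (\det _); apply/matrixP => i c; rewrite !mxE; congr (_ * _%:P).
case: i => [[|i] lt_i] //=; congr ((_ == (_ + nat_of_bool (g _)) %% _)%N%:R).
by apply: val_inj; rewrite /= inordK.
Qed.

(** A choice raising k indices carries (-1)^k X^(d-k), so this is the coefficient of X^(d-m). *)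
Lemma det_cyclic_mx_pieri a m : (m <= d)%N ->
  \sum_(g : {ffun 'I_d.+1 -> bool} | ~~ g ord0 && (\sum_i g i == m)%N)
     \det (cyclic_mx (fun j => a j + g (inord j.+1))%N)
  = (-1) ^+ m * \det (cyclic_mx a).
Proof.
move=> le_m; have := congr1 (coefp (d - m)) (det_cyclic_mx_shifts a); rewrite /coefp.
have -> : ((\sum_(i < d.+1) 'X^i) * (\det (cyclic_mx a))%:P)`_(d - m) = \det (cyclic_mx a).
  rewrite coefMC coef_sum (bigD1 (inord (d - m))) //= coefXn inordK ?ltnS ?leq_subr //.
  rewrite eqxx big1 ?addr0 ?mul1r // => i.
  by rewrite -val_eqE /= inordK ?ltnS ?leq_subr // coefXn eq_sym => /negbTE->.
move=> <-.
rewrite coef_sum big_distrr /= big_mkcondr; apply: eq_bigr => g /negbTE g0.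
have -> : (\sum_i g i = \sum_(i < d) g (lift ord0 i))%N by rewrite big_ord_recl g0.
rewrite /shift_sign big_split /= !prodrXr coefMC.
have -> : (\sum_(i < d) ~~ g (lift ord0 i) = d - \sum_(i < d) g (lift ord0 i))%N.
  apply/eqP; rewrite -(eqn_add2r (\sum_(i < d) g (lift ord0 i))) -big_split /=.
  rewrite (eq_bigr (fun=> 1%N)) => [|i _]; last by case: (g _).
  rewrite sum1_card card_ord subnK // -[leqRHS]card_ord -sum1_card.
  by apply: leq_sum => i _; case: (g _).
have le_g : (\sum_(i < d) g (lift ord0 i) <= d)%N.
  by rewrite -[leqRHS]card_ord -sum1_card; apply: leq_sum => i _; case: (g _).
move: (\sum_(i < d) _)%N le_g => k le_k.
have -> : (-1) ^+ k = ((-1) ^+ k)%:P :> {poly int} by rewrite rmorphXn rmorphN1.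
rewrite coefCM coefXn (_ : (_ == _)%N = (k == m)); last by lia.
case: eqP => [->|_]; last by rewrite mulr0 mul0r mulr0.
by rewrite mulr1 mulrA -exprD addnn -signr_odd odd_double mul1r.
Qed.
End CyclicDeterminant.

Lemma geom_coefE d n : geom_coef d n = (n <= d)%N%:R.
Proof.
rewrite /geom_coef coef_sum; case: leqP => [le_n | lt_n].
  rewrite (bigD1 (inord n)) //= coefXn inordK // eqxx big1 // => i.
  by rewrite -val_eqE /= inordK // coefXn eq_sym => /negbTE->.
rewrite big1 // => i _; rewrite coefXn gtn_eqF //.
exact: leq_trans (ltn_ord i) lt_n.
Qed.

Lemma nth_delta d k : (k < d)%N -> nth 0%N (delta d) k = (d.-1 - k)%N.
Proof.
by move=> lt_k; rewrite nth_rev size_iota // nth_iota; lia.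
Qed.

Lemma nth_delta_minus d r k : (r <= d)%N -> (k < d)%N ->
  nth 0%N (delta_minus d r) k = bump r (d.-1 - k).
Proof.
move=> le_r lt_k; rewrite /delta_minus /delta filter_rev.
have -> : [seq x <- iota 0 d.+1 | x != r] = map (bump r) (iota 0 d).
  have -> : iota 0 d.+1 = iota 0 r ++ r :: iota r.+1 (d - r).
    by rewrite -[RHS]/(iota 0 r ++ iota (0 + r) (d - r).+1) -iotaD; congr iota; lia.
  have -> : iota 0 d = iota 0 r ++ iota (0 + r) (d - r) by rewrite -iotaD subnKC.
  rewrite filter_cat /= eqxx map_cat; congr (_ ++ _).
    rewrite -[LHS]map_id (all_filterP _); last first.
      by apply/allP => x; rewrite mem_iota => /andP[_ lt_x]; rewrite ltn_eqF.
    by apply/eq_in_map => x; rewrite mem_iota /bump => /andP[_ lt_x]; rewrite leqNgt lt_x.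
  rewrite (all_filterP _); last first.
    by apply/allP => x; rewrite mem_iota => /andP[lt_x _]; rewrite gtn_eqF.
  rewrite -[r.+1]addn1 addnC iotaDl add0n.
  by apply/eq_in_map => x; rewrite mem_iota /bump => /andP[-> _].
rewrite nth_rev size_map size_iota // (nth_map 0%N) ?size_iota; last by lia.
by rewrite nth_iota; [congr bump | ]; lia.
Qed.

(** * The signed number as a cyclic determinant *)

Section CyclicSchur.
Variable d : nat.

Definition rev_perm : 'S_d := perm (@rev_ord_inj d).

(** Up to a unitriangular factor, the row of ones may be replaced by the unit row of the missing
    residue [r]. What remains is the matrix of a permutation sending 0 to [r], which accounts for
    (-1)^r; [rev_perm] appears because [delta_minus] is listed in decreasing order. *)
Lemma det_cyclic_mx_perm (a : nat -> nat) (r : 'I_d.+1) (sigma : 'S_d) :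
    (forall i : 'I_d, a i = nth 0%N (delta_minus d r) (sigma i) %[mod d.+1])%N ->
  \det (cyclic_mx d a) = (-1) ^+ r * (-1) ^+ sigma * (-1) ^+ rev_perm.
Proof.
move=> congr_a; pose pi := lift_perm ord0 r (sigma * rev_perm)%g.
pose ones_row : 'M[int]_d.+1 := \matrix_(i, k) ((i == ord0) || (i == k))%:R.
have -> : cyclic_mx d a = ones_row *m perm_mx pi.
  apply/matrixP => i c; rewrite !mxE (bigD1 (pi^-1 c)%g) //= big1 ?addr0; last first.
    move=> k ne_k; rewrite !mxE (_ : pi k == c = false) ?mulr0 //.
    by apply: contraNF ne_k => /eqP <-; rewrite permK.
  rewrite !mxE permKV eqxx mulr1; case: (unliftP ord0 i) => [i' -> | ->] //=.
  rewrite congr_a nth_delta_minus ?ltn_ord // -1?ltnS ?ltn_ord //; congr (_%:R).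
  congr nat_of_bool; rewrite modn_small; last first.
    by rewrite /bump; have := ltn_ord i'; lia.
  rewrite -(inj_eq (@perm_inj _ pi)) permKV eq_sym -val_eqE lift_perm_lift permM permE /=.
  by congr (bump _ _ == _); have := ltn_ord (sigma i'); lia.
have -> : \det (ones_row *m perm_mx pi) = \det ones_row^T * (-1) ^+ pi.
  by rewrite det_mulmx det_tr det_perm.
rewrite det_trig ?big1 ?mul1r => [|i _|]; last 2 first.
- by rewrite !mxE eqxx orbT.
- apply/is_trig_mxP => i j lt_ij; rewrite !mxE -!val_eqE /= !gtn_eqF //.
  exact: leq_ltn_trans lt_ij.
by rewrite odd_lift_perm odd_permM /= !signr_addb signr_odd mulrA.
Qed.

Definition beta lam (j : nat) : nat := (nth 0%N (conj_part lam) j + (d.-1 - j))%N.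

(** The sign in front cancels [rev_perm] and makes the value at the empty partition 1. The test says
    that lam' has at most [d] parts. *)
Definition cyclic_schur lam : int :=
  if (nth 0%N lam 0 <= d)%N
  then (-1) ^+ (sumn lam + d) * (-1) ^+ rev_perm * \det (cyclic_mx d (beta lam)) else 0.

Lemma cyclic_schur_congr lam (r : 'I_d.+1) (sigma : 'S_d) :
  congr_delta lam r sigma ->
  cyclic_schur lam = (-1) ^+ (sumn lam + d + r) * (-1) ^+ sigma.
Proof.
rewrite /congr_delta size_conj_part /cyclic_schur => -[-> congr_lam].
rewrite (@det_cyclic_mx_perm _ r sigma) => [|i]; last first.
  by rewrite -congr_lam nth_delta.
have mulE (x y z w : int) : x * w * (y * z * w) = x * y * z * w ^+ 2 by ring.
by rewrite mulE sqrr_sign mulr1 [in RHS]exprD.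
Qed.

(** If the [d] beta numbers are distinct modulo d + 1, they miss a residue [r] and enumerate the
    others, which produces a congruence. Otherwise two rows agree. *)
Lemma cyclic_schur_eq0 lam :
  (forall (r : 'I_d.+1) (sigma : 'S_d), ~ congr_delta lam r sigma) ->
  cyclic_schur lam = 0.
Proof.
move=> no_congr; rewrite /cyclic_schur; case: leqP => // le_d.
pose rho (i : 'I_d) : 'I_d.+1 := inord (beta lam i %% d.+1).
have rhoE i : rho i = (beta lam i %% d.+1)%N :> nat by rewrite inordK // ltn_pmod.
have [/injectiveP inj_rho | /injectivePn[i [j ne_ij eq_rho]]] :=
  boolP (injectiveb rho); last first.
  rewrite (_ : \det _ = 0) ?mulr0 //.
  have eq_mod : (beta lam i = beta lam j %[mod d.+1])%N by rewrite -!rhoE eq_rho.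
  have : (i != j :> nat) by [].
  rewrite neq_ltn => /orP[lt_ij | lt_ji].
    by apply: det_cyclic_mx_eq0 eq_mod; rewrite lt_ij ltn_ord.
  by apply: det_cyclic_mx_eq0 (esym eq_mod); rewrite lt_ji ltn_ord.
have [r r_out] : exists r, r \notin codom rho.
  apply/existsP; rewrite -[X in is_true X]negbK negb_exists.
  apply/negP => /forallP all_in; have : (#|'I_d.+1| <= #|codom rho|)%N.
    by apply/subset_leq_card/subsetP => r _; rewrite -[_ \in _]negbK.
  by rewrite card_codom // !card_ord ltnn.
have unlift_rho i : exists k, rho i = lift r k.
  case: (unliftP r (rho i)) => [k def_k | def_r]; first by exists k.
  by rewrite -def_r codom_f in r_out.
(* The default [i] is never reached, as [r] is not a value of [rho]. *)
pose s i : 'I_d := odflt i (unlift r (rho i)).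
have lift_s i : lift r (s i) = rho i.
  by have [k def_k] := unlift_rho i; rewrite /s def_k liftK.
have inj_s : injective s by move=> i j eq_s; apply: inj_rho; rewrite -!lift_s eq_s.
case: (no_congr r (perm inj_s * rev_perm)%g); split; first by rewrite size_conj_part.
move=> i; rewrite nth_delta // nth_delta_minus // -1?ltnS // permM !permE /=.
have -> : (d.-1 - (d - (s i).+1) = s i)%N by have := ltn_ord (s i); lia.
rewrite -[bump r (s i)]/(nat_of_ord (lift r (s i))) lift_s rhoE modn_mod //.
Qed.

Lemma cyclic_schur_nil : cyclic_schur [::] = 1.
Proof.
(* Deleting [d] from delta_(d+1) leaves delta_d, so r = d and the identity permutation fit. *)
rewrite (@cyclic_schur_congr [::] ord_max 1%g); first
  by rewrite odd_perm1 mulr1 addnn -signr_odd odd_double.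
split=> // i; rewrite nth_nil nth_delta // nth_delta_minus // perm1 /bump.
by congr (_ %% _)%N; have := ltn_ord i; rewrite /=; lia.
Qed.

(** Strips of size [m] correspond to the choices of [m] raised columns that keep the columns
    decreasing, and the other choices contribute 0. The factor (-1)^m of [det_cyclic_mx_pieri]
    cancels the change of (-1)^|lam|. *)
Lemma cyclic_schur_pieri : pieri_rule (geom_coef d) cyclic_schur.
Proof.
move=> mu m pmu; rewrite geom_coefE /cyclic_schur.
have [le_mu | lt_mu] := leqP (nth 0%N mu 0) d; last first.
  rewrite mulr0 big1 // => lam /hstripP/(_ 0%N)[le0 _].
  by rewrite leqNgt (leq_trans lt_mu le0).
have sum_conj lam : is_part lam -> (nth 0%N lam 0 <= d)%N ->
    sumn lam = (\sum_(j < d) nth 0%N (conj_part lam) j)%N.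
  by move=> plam le_d; rewrite -(sumn_conj plam) (@sumn_nth _ d) // size_conj_part.
(* For m > d, no lam with at most [d] columns occurs, since each column gains at most one cell. *)
have [le_m | lt_m] := leqP m d; last first.
  rewrite mul0r big_seq_cond big1 // => lam; rewrite mem_partitions_of.
  move=> /andP[/andP[plam /eqP sum_lam] /(hstrip_conjP plam pmu) hs].
  case: leqP => // le_lam; have := sum_lam; rewrite (sum_conj lam) // (sum_conj mu) //.
  have : (\sum_(j < d) nth 0 (conj_part lam) j
          <= \sum_(j < d) (nth 0 (conj_part mu) j + 1))%N.
    by apply: leq_sum => j _; rewrite addn1; case/andP: (hs j).
  by rewrite big_split /= sum1_card card_ord; lia.
rewrite -big_mkcondr mul1r.
pose col_step lam : {ffun 'I_d.+1 -> bool} :=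
  [ffun i : 'I_d.+1 => (0 < i) && (nth 0 (conj_part lam) i.-1 != nth 0 (conj_part mu) i.-1)]%N.
pose new_col (g : {ffun 'I_d.+1 -> bool}) j := (nth 0 (conj_part mu) j + g (inord j.+1))%N.
pose decreasing (g : {ffun 'I_d.+1 -> bool}) :=
  [forall i : 'I_d, forall j : 'I_d, (j == i.+1 :> nat) ==> (new_col g j <= new_col g i)]%N.
pose D (g : {ffun 'I_d.+1 -> bool}) :=
  \det (cyclic_mx d (fun j => beta mu j + g (inord j.+1))%N).
have sum_new_col (g : {ffun 'I_d.+1 -> bool}) : ~~ g ord0 ->
    (\sum_(j < d) new_col g j = sumn mu + \sum_i g i)%N.
  move=> /negbTE g0; rewrite (sum_conj mu) // big_split /= big_ord_recl g0 add0n.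
  congr (_ + _)%N; apply: eq_bigr => j _; congr (nat_of_bool (g _)).
  by apply: val_inj; rewrite /= inordK // ltnS.
have new_colE lam j : is_part lam -> hstrip lam mu -> (j < d)%N ->
    new_col (col_step lam) j = nth 0%N (conj_part lam) j.
  move=> plam /(hstrip_conjP plam pmu)/(_ j) hs lt_j.
  by rewrite /new_col ffunE inordK //=; case: eqP hs; lia.
have conj_default lam j : (nth 0%N lam 0 <= d)%N -> (d <= j)%N ->
    nth 0%N (conj_part lam) j = 0%N.
  by move=> le_d le_j; rewrite nth_default // size_conj_part (leq_trans le_d).
transitivity (\sum_(g : {ffun 'I_d.+1 -> bool} |
    [&& ~~ g ord0, (\sum_i g i == m)%N & decreasing g])
    (-1) ^+ (sumn mu + m + d) * (-1) ^+ rev_perm * D g).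
  apply: (big_seq_reindex (phi := col_step)); first exact: partitions_of_uniq.
  - move=> lam lam'; rewrite !inE !mem_partitions_of.
    move=> /andP[/andP[plam _] /andP[hs le_d]] /andP[/andP[plam' _] /andP[hs' le_d']] eq_step.
    rewrite -(conj_partK plam) -(conj_partK plam'); congr conj_part.
    apply: eq_part; try exact: is_part_conj; move=> j.
    have [lt_j | ge_j] := ltnP j d; last by rewrite !conj_default.
    by rewrite -!new_colE // eq_step.
  - move=> lam; rewrite mem_partitions_of => /andP[plam /eqP sum_lam] /andP[hs le_d].
    have step0 : ~~ col_step lam ord0 by rewrite ffunE.
    split.
      rewrite step0 -(eqn_add2l (sumn mu)) -sum_new_col // -sum_lam (sum_conj lam) //.
      rewrite /=; apply/andP; split; first by apply/eqP; apply: eq_bigr => j _; rewrite new_colE.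
      apply/'forall_forallP => i j; apply/implyP => /eqP def_j.
      by rewrite !new_colE // def_j part_nth_anti // is_part_conj.
    rewrite sum_lam; congr (_ * \det _); apply: eq_cyclic_mx => j lt_j.
    by rewrite /beta addnAC -new_colE.
  - move=> g /and3P[g0 /eqP sum_g /'forall_forallP g_dec].
    pose h j := if (j < d)%N then new_col g j else 0%N.
    have [||pnu nuE] := @part_ofP h d.
    + move=> j; rewrite /h; case: ltnP => // lt_j; rewrite (ltnW lt_j).
      by have := g_dec (Ordinal (ltnW lt_j)) (Ordinal lt_j); rewrite eqxx.
    + by rewrite /h ltnn.
    set nu := part_of h d in pnu nuE.
    have plam := is_part_conj pnu; have conjE := conj_partK pnu; exists (conj_part nu).
    have size_nu : (size nu <= d)%N by rewrite leqNgt -part_nth_gt0 // nuE /h ltnn.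
    split.
    + rewrite mem_partitions_of plam sumn_conj // (sumn_nth size_nu) /= -sum_g.
      rewrite -sum_new_col //; apply/eqP; apply: eq_bigr => j _.
      by rewrite nuE /h ltn_ord.
    + rewrite -size_conj_part conjE size_nu andbT; apply/hstrip_conjP => // j.
      rewrite conjE nuE /h; case: ltnP => [lt_j | ge_j]; last by rewrite conj_default.
      by rewrite /new_col; case: (g _); lia.
    apply/ffunP => -[[|i] lt_i]; rewrite ffunE /=.
      by rewrite (_ : Ordinal lt_i = ord0) ?(negbTE g0) //; apply: val_inj.
    rewrite conjE nuE /h -[(i < d)%N]ltnS lt_i /new_col.
    rewrite (_ : inord i.+1 = Ordinal lt_i); last by apply: val_inj; rewrite /= inordK.
    by case: (g _); lia.
rewrite -big_distrr /= addnAC exprD -!mulrA; congr (_ * _); rewrite mulrCA; congr (_ * _).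
transitivity ((-1) ^+ m * ((-1) ^+ m * \det (cyclic_mx d (beta mu)))); last first.
  by rewrite mulrA -expr2 sqrr_sign mul1r.
congr (_ * _); rewrite -det_cyclic_mx_pieri // [RHS](bigID decreasing) /=.
(* Decrease fails only when two adjacent columns of mu are equal and just the right one is raised;
   their beta numbers, which differed by 1, then coincide. *)
rewrite [X in _ = _ + X]big1 ?addr0 => [|g /andP[_ /forallPn[i /forallPn[j]]]]; last first.
  rewrite negb_imply => /andP[/eqP def_j lt_new].
  apply: (@det_cyclic_mx_eq0 _ _ i j); first by rewrite def_j ltnSn -def_j ltn_ord.
  congr (_ %% _)%N; move: lt_new (ltn_ord j); rewrite /new_col /beta def_j.
  have := part_nth_anti (is_part_conj pmu) (leqnSn i).
  by case: (g _); case: (g _); lia.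
by apply: eq_bigl => g; rewrite andbA.
Qed.

End CyclicSchur.

Lemma schur_coefE (R : comNzRingType) (f : nat -> R) (s : seq nat -> R) lam :
  is_schur_expansion f s -> is_part lam -> schur_coef f lam = s lam.
Proof.
move=> exp_s; apply: (@schur_expansion_uniq _ f) => //.
by apply: epsilon_spec; exists s.
Qed.

Theorem proposition2p9 (d : nat) (hd : (0 < d)%N)
    (lam : seq nat) (hlam : is_part lam) :
  [/\ schur_coef (geom_coef d) lam
      = \det (\matrix_(i < size lam, j < size lam)
                coefz (geom_coef d) ((nth 0%N lam i)%:Z - i%:Z + j%:Z)),
      schur_coef (geom_coef d) lam \in [:: 1; -1; 0],
      forall (r : 'I_d.+1) (sigma : 'S_d), congr_delta lam r sigma ->
        schur_coef (geom_coef d) lam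
        = (-1) ^+ (sumn lam + d + r) * (-1) ^+ sigma
    & (forall (r : 'I_d.+1) (sigma : 'S_d), ~ congr_delta lam r sigma) ->
        schur_coef (geom_coef d) lam = 0].
Proof.
have jt_exp : is_schur_expansion (geom_coef d)
    (fun lam => jacobi_trudi (geom_coef d) (size lam) lam).
  apply: schur_expansion_of_pieri; first by rewrite /jacobi_trudi det_mx00.
  apply: (@jacobi_trudi_pieri _ _ _ d) => [|k lt_k]; rewrite geom_coefE //.
  by rewrite leqNgt lt_k.
have cyc_exp : is_schur_expansion (geom_coef d) (@cyclic_schur d).
  by apply: schur_expansion_of_pieri; [apply: cyclic_schur_nil | apply: cyclic_schur_pieri].
have coefE := schur_coefE cyc_exp hlam; split.
- exact: schur_coefE jt_exp hlam.
- rewrite coefE; case: (excluded_middle_informative (exists r, exists sigma,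
    @congr_delta d lam r sigma)) => [[r [sigma cong]] | no_congr].
    rewrite (cyclic_schur_congr cong) -signr_odd -signr_addb.
    by case: (_ (+) _); rewrite !inE eqxx ?orbT.
  rewrite cyclic_schur_eq0 ?inE ?eqxx ?orbT // => r sigma cong.
  by apply: no_congr; exists r, sigma.
- by move=> r sigma cong; rewrite coefE; apply: cyclic_schur_congr.
- by move=> no_congr; rewrite coefE; apply: cyclic_schur_eq0.
Qed.
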